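(* Let $G$ be an amenable group generated by a finite symmetric set $S$, let $\mathcal A$ be a finite set and $\mathcal C:G\to\mathcal A$ a colouring. Let $(Q_n)_{n\in\mathbb N}$ be a Følner sequence in $G$ such that each $Q_n$ symmetrically tiles $G$, and let $(U_j)_{j\in\mathbb N}$ be a Følner sequence along which the frequencies $\nu_P=\lim_{j\to\infty}|U_j|^{-1}\sharp_P(\mathcal C|_{U_j})$ exist for all patterns $P\in\bigcup_{n\in\mathbb N}\mathcal P(Q_n)$. Let $(X,\|\cdot\|)$ be a Banach space and let $F:\mathcal F(G)\to X$ be $\mathcal C$-invariant and almost additive with boundary term $b$. Let $C>0$ be a constant with $\|F(Q)\|\le C|Q|$ for all $Q\in\mathcal F(G)$ (such a constant exists) and let $D>0$ be a constant with $b(Q)\le D|Q|$ for all $Q\in\mathcal F(G)$. Then the limits $$\overline F:=\lim_{j\to\infty}\frac{F(U_j)}{|U_j|}=\lim_{n\to\infty}\sum_{P\in\mathcal P(Q_n)}\nu_P\frac{\tilde F(P)}{|Q_n|}$$ exist and are equal. Furthermore, for $j,n\in\mathbb N$ the difference $$\Delta(j,n):=\Big\|\frac{F(U_j)}{|U_j|}-\sum_{P\in\mathcal P(Q_n)}\nu_P\frac{\tilde F(P)}{|Q_n|}\Big\|$$ satisfies $$\Delta(j,n)\le\frac{b(Q_n)}{|Q_n|}+(C+D)\frac{|\partial^{\operatorname{diam}(Q_n)}U_j|}{|U_j|}+C\sum_{P\in\mathcal P(Q_n)}\Big|\frac{\sharp_P(\mathcal C|_{U_j})}{|U_j|}-\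nu_P\Big|.$$
   Context: Symmetric means $S=S^{-1}$. Word metric: $d_S(g,h)$ is the minimal $L\in\mathbb N_0$ such that $g^{-1}h$ is a product of $L$ elements of $S$. $\mathcal F(G)$ is the set of finite subsets of $G$, $|Q|$ is cardinality, $\operatorname{diam}(Q)=\max\{d_S(g,h): g,h\in Q\}$. For $Q\in\mathcal F(G)$ and $R\ge 0$: $\partial_{int}^R(Q)=\{x\in Q: d_S(x,G\setminus Q)\le R\}$, $\partial_{ext}^R(Q)=\{x\in G\setminus Q: d_S(x,Q)\le R\}$, $\partial^R(Q)=\partial^R_{int}(Q)\cup\partial^R_{ext}(Q)$. A Følner sequence is a sequence $(Q_n)$ of finite (nonempty) subsets of $G$ with $\lim_{n\to\infty} |Q_nS\setminus Q_n|/|Q_n|=0$. A set $Q\subseteq G$ symmetrically tiles $G$ if there is $K\subseteq G$ with $K=K^{-1}$ such that the sets $Qg$, $g\in K$, are pairwise disjoint and have union $G$. A colouring is a map $\mathcal C:G\to\mathcal A$; a pattern is a map $P:D(P)\to\mathcal A$ with $D(P)\in\mathcal F(G)$; $\mathcal P$ is the set of all patterns, $\mathcal P(Q)$ the set of patterns with domain $Q$. The translate $Px$ ($x\in G$) is the pattern $D(P)x\to\mathcal A$, $yx\mapsto P(y)$. Two patterns are equivalent if one is a translate of the other. $\sharp_P(P')=|\{x\in G: D(P)x\subseteq D(P'),\ P'|_{D(P)x}=Px\}|$. The limit $\nu_P=\lim_j\sharp_P(\mathcal C|_{U_j})/|U_j|$, if it exists, is called the frequency of $P$ in $\mathcal C$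 along $(U_j)$. A boundary term is a function $b:\mathcal F(G)\to[0,\infty)$ such that (a) $b(Qx)=b(Q)$ for all $x\in G$, $Q\in\mathcal F(G)$; (b) $b(V_j)/|V_j|\to0$ for every Følner sequence $(V_j)$; (c) there is $D>0$ with $b(Q)\le D|Q|$ for all $Q\in\mathcal F(G)$. $F:\mathcal F(G)\to X$ is $\mathcal C$-invariant if $F(Q)=F(Qx)$ whenever $\mathcal C|_Q$ and $\mathcal C|_{Qx}$ are equivalent patterns, and almost additive with boundary term $b$ if $\|F(\bigcup_{k=1}^mQ_k)-\sum_{k=1}^mF(Q_k)\|\le\sum_{k=1}^mb(Q_k)$ for all pairwise disjoint $Q_1,\dots,Q_m\in\mathcal F(G)$. For a pattern $P$, $\tilde F(P):=F(Q)$ if there is $Q\in\mathcal F(G)$ such that $\mathcal C|_Q$ is equivalent to $P$ (well defined by $\mathcal C$-invariance), and $\tilde F(P):=0$ otherwise.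
   Formalization: Word metric taken as the length of gh^{-1} and Følner condition as |SQ_n∖Q_n|/|Q_n|→0, instead of g^{-1}h and |Q_nS∖Q_n|; with right translates Qx the version as stated fails on the lamplighter group (U_j suitable left translates of Q_j). Commutative G is unaffected. *)

(* Defs.v *)
From HB Require Import structures.
From mathcomp Require Import all_boot all_order all_algebra finmap.
From mathcomp Require Import all_classical all_reals all_analysis.

Set Implicit Arguments.
Unset Strict Implicit.
Unset Printing Implicit Defensive.

Import Order.TTheory GRing.Theory Num.Theory.
Import numFieldNormedType.Exports.

Local Open Scope classical_set_scope.
Local Open Scope ring_scope.

(* F(G) is {fset G}, and |Q| is #|` Q|. *)

Section WordMetric.
Variables (G : groupType) (S : {fset G}).

Definition symmetric_gens : Prop := S = [fset (s^-1)%g | s in S]%fset.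

Definition is_word (L : nat) (g : G) : Prop :=
  exists w : seq G,
    [/\ size w = L, {subset w <= S} & g = (\prod_(s <- w) s)%g].

(* For symmetric S, the subgroup generated by S consists of the products of
   elements of S. *)
Definition generates : Prop := forall g : G, exists L, is_word L g.

(* Patterns, tilings and boundary terms below all use right translates Q x, so
   the metric has to be the right-invariant one, given by g h^-1, for the
   translates Q x to be isometric to Q. This matters as soon as G is not
   commutative: with the left-invariant metric, given by g^-1 h, and Q S in place
   of S Q in [folner], the ergodic theorem fails on the lamplighter group.
   The value 0 for unreachable pairs is junk: there are none if S generates G. *)
Definition word_dist (g h : G) : nat :=
  if pselect (exists L, `[< is_word L (g * h^-1)%g >]) is left e
  then ex_minn e else 0.

Definition diam (Q : {fset G}) : nat :=
  (\max_(g <- Q) \max_(h <- Q) word_dist g h)%N.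

(* Extended real, so that the distance to the empty set is +oo. *)
Definition set_dist (R : realType) (x : G) (A : set G) : \bar R :=
  ereal_inf [set (word_dist x y)%:R%:E | y in A].

Definition int_boundary (R : realType) (r : R) (Q : {fset G}) : set G :=
  [set x | x \in Q /\ (set_dist R x (~` [set` Q]) <= r%:E)%E].

Definition ext_boundary (R : realType) (r : R) (Q : {fset G}) : set G :=
  [set x | x \notin Q /\ (set_dist R x [set` Q] <= r%:E)%E].

Definition boundary (R : realType) (r : R) (Q : {fset G}) : set G :=
  int_boundary r Q `|` ext_boundary r Q.

End WordMetric.

Section Amenability.
Variables (R : realType) (G : groupType) (S : {fset G}).

(* Left products S Q, to match the right-invariant [word_dist]. *)
Definition folner (Q : nat -> {fset G}) : Prop :=
  (forall n, Q n != fset0) /\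
  (fun n => #|` [fset (s * x)%g | s in S, x in Q n] `\` Q n |%:R
              / #|` Q n|%:R : R)%fset @ \oo --> (0 : R).

Definition amenable : Prop := exists Q : nat -> {fset G}, folner Q.

Record boundary_term (b : {fset G} -> R) : Prop := {
  boundary_term_ge0 : forall Q, 0 <= b Q;
  boundary_term_inv : forall (Q : {fset G}) (x : G),
    b [fset (y * x)%g | y in Q]%fset = b Q;
  boundary_term_folner : forall V : nat -> {fset G}, folner V ->
    (fun j => b (V j) / #|` V j|%:R) @ \oo --> (0 : R);
  boundary_term_bound : exists2 D : R, 0 < D & forall Q, b Q <= D * #|` Q|%:R
}.

End Amenability.

Section Patterns.
Variables (G : groupType) (A : finType).
Implicit Types (Q : {fset G}) (P : {fmap G -> A}) (x : G).

Definition rtrans Q x : {fset G} := [fset (y * x)%g | y in Q]%fset.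

Definition symmetrically_tiles Q : Prop :=
  exists K : set G,
    [/\ K = [set (g^-1)%g | g in K],
        forall g h, K g -> K h -> g <> h ->
          [disjoint rtrans Q g & rtrans Q h]%fset
      & \bigcup_(g in K) [set` rtrans Q g] = [set: G]].

(* A pattern is a finite map P : {fmap G -> A}, with D(P) = domf P; the set P(Q)
   of patterns with domain Q is the image of {ffun Q -> A} under [FinMap]. *)

Definition restriction (C : G -> A) Q : {fmap G -> A} :=
  [fmap y : Q => C (val y)]%fmap.

Lemma mem_rtransV Q x (z : rtrans Q x) : (val z * x^-1)%g \in Q.
Proof. by case: z => z /= /imfsetP[y yQ ->]; rewrite mulgK. Qed.

Definition translate P x : {fmap G -> A} :=
  [fmap z : rtrans (domf P) x => P.[mem_rtransV z]]%fmap.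

Lemma fnd_translate P x z :
  (translate P x).[? z]%fmap = P.[? (z * x^-1)%g]%fmap.
Proof.
have [zPx|zNPx] := boolP (z \in domf (translate P x)).
  have zP := mem_rtransV [` zPx]%fset.
  by rewrite (in_fnd zPx) (in_fnd zP) ffunE; congr Some; apply: eq_getf.
rewrite !not_fnd //; apply: contra zNPx => zP.
by apply/imfsetP; exists (z * x^-1)%g; rewrite ?mulgVK.
Qed.

Definition equivalent P P' : Prop :=
  (exists x, P' = translate P x) \/ (exists x, P = translate P' x).

Lemma equivalentP P P' : equivalent P P' <-> exists x, P' = translate P x.
Proof.
split=> [[//|[x ->]]|]; last by left.
by exists x^-1%g; apply/fmapP => z; rewrite !fnd_translate invgK mulgK.
Qed.

Definition occurrences P P' : set G :=
  [set x | (rtrans (domf P) x `<=` domf P')%fset /\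
           P'.[& rtrans (domf P) x]%fmap = translate P x].

(* [fset_set] is only meaningful on finite sets; [occurrences P P'] is finite
   as soon as D(P) is nonempty. *)
Definition occ_count P P' : nat := #|` fset_set (occurrences P P')|.

Lemma finite_occurrences P P' :
  domf P != fset0 -> finite_set (occurrences P P').
Proof.
case/fset0Pn=> y yP.
apply: (@sub_finite_set _ _ ((fun z => y^-1 * z)%g @` [set` domf P'])).
  move=> x [/fsubsetP sub _]; exists (y * x)%g; last by rewrite mulKg.
  by apply: sub; apply/imfsetP; exists y.
by apply: finite_image; apply: finite_fset.
Qed.

(* Only meaningful where the limit exists. *)
Definition frequency (R : realType) (C : G -> A) (U : nat -> {fset G}) P : R :=
  lim ((fun j => (occ_count P (restriction C (U j)))%:R / #|` U j|%:R : R)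
       @ \oo).

Section Functions.
Variables (R : realType) (X : completeNormedModType R).
Implicit Types F : {fset G} -> X.

Definition pattern_invariant (C : G -> A) F : Prop :=
  forall Q x, equivalent (restriction C Q) (restriction C (rtrans Q x)) ->
    F Q = F (rtrans Q x).

Definition Ftilde (C : G -> A) F P : X :=
  if pselect (exists Q, equivalent (restriction C Q) P) is left e
  then F (projT1 (cid e)) else 0.

Lemma FtildeE C F P Q : pattern_invariant C F -> equivalent (restriction C Q) P ->
  Ftilde C F P = F Q.
Proof.
move=> Finv QP; rewrite /Ftilde; case: pselect => [e|]; last by case; exists Q.
case: cid => Q' /= /equivalentP[x' Px'].
case/equivalentP: QP => x Px.
have eqv : restriction C Q' = translate (restriction C Q) (x * x'^-1)%g.
  apply/fmapP => z; rewrite fnd_translate.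
  have /fmapP/(_ (z * x')%g) := etrans (esym Px) Px'.
  by rewrite !fnd_translate mulgK invgM invgK mulgA.
have defQ' : Q' = rtrans Q (x * x'^-1)%g by have := congr1 (@domf _ _) eqv.
by rewrite defQ'; symmetry; apply: Finv; rewrite -defQ'; left; exists (x * x'^-1)%g.
Qed.

End Functions.
End Patterns.

Definition almost_additive (G : groupType) (R : realType)
    (X : completeNormedModType R) (b : {fset G} -> R) (F : {fset G} -> X) :
    Prop :=
  forall (m : nat) (Q : 'I_m.+1 -> {fset G}),
    (forall i j, i != j -> [disjoint Q i & Q j]%fset) ->
    `|F (\big[fsetU/fset0]_(i < m.+1) Q i)%fset - \sum_i F (Q i)| <= \sum_i b (Q i).

(* Main.v *)
(* Inverting the tiling [G = \bigcup_(g in K) Q g], [K = K^-1], shows that every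
   [z] lies in [K x^-1] for exactly one [x] in [Q]. So the [#|Q|] tilings by
   [{Q z | z in K x^-1}], [x] in [Q], together use every translate of [Q] exactly
   once. Almost additivity along each of them, averaged over [x], compares
   [#|Q| F(U)] with the sum of [F (Q z)] over all [Q z] contained in [U], and
   this sum counts the pattern occurrences in [C|_U]. The pieces that stick out
   of [U] meet it inside its boundary. Letting [j] and then [n] tend to infinity
   in the resulting estimate gives a Cauchy argument for the limit. *)

Require Import Defs.
From HB Require Import structures.
From mathcomp Require Import all_boot all_order all_algebra finmap.
From mathcomp Require Import all_classical all_reals all_analysis.
From mathcomp Require Import ring.

Set Implicit Arguments.
Unset Strict Implicit.
Unset Printing Implicit Defensive.

Import Order.TTheory GRing.Theory Num.Theory.
Import numFieldNormedType.Exports.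

Local Open Scope classical_set_scope.
Local Open Scope ring_scope.

(** * Limits at zero and a product bound for cardinalities *)

Lemma cvg0_le_mul (R : realType) (M : R) (u v : nat -> R) :
  (forall j, 0 <= u j <= M * v j) -> v @ \oo --> (0 : R) ->
  u @ \oo --> (0 : R).
Proof.
move=> le_uv v0; have : (fun j => M * v j) @ \oo --> M * 0 by apply: cvgMl_tmp.
rewrite mulr0; apply: (squeeze_cvgr (f := fun=> 0)); first exact: nearW.
exact: cvg_cst.
Qed.

Lemma cvg0_sum (R : realType) (I : Type) (r : seq I) (h : I -> nat -> R) :
  (forall i, h i @ \oo --> (0 : R)) ->
  (fun j => \sum_(i <- r) h i j) @ \oo --> (0 : R).
Proof.
move=> h0.
have : (fun j => \sum_(i <- r) h i j) @ \oo --> \sum_(i <- r) (0 : R).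
  by apply: cvg_big => //; exact: add_continuous.
by rewrite big1.
Qed.

Lemma leq_card_imfset2 (T T' K : choiceType) (f : T -> T' -> K)
    (V : {fset T}) (W : {fset T'}) :
  (#|` [fset f x y | x in V, y in W]%fset| <= #|` V| * #|` W|)%N.
Proof.
rewrite -(size_allpairs f); apply: uniq_leq_size => [|z /imfset2P[x /= xV]].
  exact: fset_uniq.
by move=> [y /= yW ->]; apply/allpairsP; exists (x, y).
Qed.

(** * Word metric, balls and boundaries *)

Section Words.
Variables (G : groupType) (S : {fset G}).

(** Generation excludes the junk value 0, so the minimum is attained by an actual word. *)
Lemma word_dist_word (g h : G) :
  generates S -> is_word S (word_dist S g h) (g * h^-1)%g.
Proof.
move=> gen; rewrite /word_dist; case: pselect => [e|].
  by case: ex_minnP => m /asboolP.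
by case; have [L gL] := gen (g * h^-1)%g; exists L; apply/asboolP.
Qed.

Lemma word_distMr (g h x : G) :
  word_dist S (g * x)%g (h * x)%g = word_dist S g h.
Proof.
have E : (g * x * (h * x)^-1 = g * h^-1)%g by rewrite invgM mulgA mulgK.
by rewrite /word_dist E.
Qed.

Lemma word_dist_diam (Q : {fset G}) (g h : G) :
  g \in Q -> h \in Q -> (word_dist S g h <= diam S Q)%N.
Proof.
move=> gQ hQ; pose m g' := (\max_(h' <- Q) word_dist S g' h')%N.
apply: (@leq_trans (m g)).
  exact: (@leq_bigmax_seq _ _ xpredT (word_dist S g) h).
exact: (@leq_bigmax_seq _ _ xpredT m g).
Qed.

(** Distances are integers: if no point of [V] is within [r], all are at distance at least [r + 1],
    and so is the infimum. This covers empty [V], where it is [+oo]. *)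
Lemma set_dist_le (R : realType) (x : G) (V : set G) (r : nat) :
  (set_dist S R x V <= r%:R%:E)%E <-> exists2 y, V y & (word_dist S x y <= r)%N.
Proof.
split=> [le_r|[y Vy le_r]]; last first.
  apply: le_trans (ereal_inf_lbound _) _; first by exists y.
  by rewrite lee_fin ler_nat.
apply: contrapT => far.
suff : (r.+1%:R%:E <= set_dist S R x V)%E.
  by move=> /le_trans/(_ le_r); rewrite lee_fin ler_nat ltnn.
apply: le_ereal_inf_tmp => _ [y Vy <-]; rewrite lee_fin ler_nat ltnNge.
by apply/negP => le_y; apply: far; exists y.
Qed.

Fixpoint word_ball (r : nat) : {fset G} :=
  if r is r'.+1 then
    (word_ball r' `|` [fset (s * g)%g | s in S, g in word_ball r'])%fset
  else [fset 1%g]%fset.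

Lemma word_ballS r : (word_ball r `<=` word_ball r.+1)%fset.
Proof. exact: fsubsetUl. Qed.

Lemma word_ball1 r : 1%g \in word_ball r.
Proof.
by elim: r => [|r IH]; [rewrite /= inE | apply: (fsubsetP (word_ballS r))].
Qed.

Lemma word_ballMl r s g : s \in S -> g \in word_ball r ->
  (s * g)%g \in word_ball r.+1.
Proof.
move=> sS gB; rewrite /= inE; apply/orP; right.
by apply/imfset2P; exists s => //; exists g.
Qed.

Lemma sub_word_ball m n : (m <= n)%N -> (word_ball m `<=` word_ball n)%fset.
Proof.
move=> /subnK <-; elim: (n - m)%N => [|k IH]; first exact: fsubset_refl.
exact: fsubset_trans IH (word_ballS _).
Qed.

(* Some step of the path from [y] to [w y] crosses the border of [U]; as
   [S = S^-1], the endpoint of that step outside [U] lies in [S U \ U]. *)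
Lemma word_exit (U : {fset G}) (w : seq G) (y : G) :
  symmetric_gens S -> {subset w <= S} ->
  (y \in U) != ((\prod_(s <- w) s)%g * y \in U)%g ->
  exists g u, [/\ g \in word_ball (size w),
    u \in ([fset (s * x)%g | s in S, x in U] `\` U)%fset &
    ((\prod_(s <- w) s) * y = g * u)%g].
Proof.
move=> Ssym; elim: w => [|s w IH] wS; first by rewrite big_nil mul1g eqxx.
rewrite big_cons -mulgA; set v := (_ * y)%g => neq.
have sS : s \in S by apply: wS; rewrite inE eqxx.
have {}wS : {subset w <= S} by move=> t tw; apply: wS; rewrite inE tw orbT.
have [eq_v|neq_v] := eqVneq (v \in U) (s * v \in U)%g.
  have [|g [u [gB uU E]]] := IH wS; first by rewrite -/v eq_v.
  by exists (s * g)%g, u; split => //; [apply: word_ballMl | rewrite -mulgA -E].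
have [vU|vU] := boolP (v \in U); rewrite ?vU ?(negPf vU) in neq_v.
  exists 1%g, (s * v)%g; split; [exact: word_ball1| |by rewrite mul1g].
  rewrite !inE; apply/andP; split; first by case: (_ \in U) neq_v.
  by apply/imfset2P; exists s => //; exists v.
exists s, v; split => //.
  by rewrite -[s]mulg1; apply: word_ballMl => //; apply: word_ball1.
rewrite !inE vU /=; apply/imfset2P; exists s^-1%g.
  by rewrite /= Ssym; apply/imfsetP; exists s.
by exists (s * v)%g; rewrite ?mulKg //=; case: (_ \in U) neq_v.
Qed.

Lemma boundary_sub (R : realType) (r : nat) (U : {fset G}) :
  symmetric_gens S -> generates S ->
  boundary S (r%:R : R) U `<=`
    [set` [fset (g * u)%g | g in word_ball r,
             u in [fset (s * x)%g | s in S, x in U] `\` U]%fset].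
Proof.
move=> Ssym gen x xbd.
(* Interior and exterior boundary points are treated alike: some [y] within [r] lies on the other
   side of [U]. A shortest word leading from [y] to [x] must then cross the border. *)
have [y le_r neq] : exists2 y,
    (word_dist S x y <= r)%N & (y \in U) != (x \in U).
  case: xbd => -[xU /set_dist_le[y yU le_r]]; exists y => //.
    by rewrite xU; apply/negP => /eqP; apply/negP/negP.
  by rewrite yU eq_sym (negPf xU).
have [w [szw wS defw]] := word_dist_word x y gen.
have defx : x = ((\prod_(s <- w) s) * y)%g by rewrite -defw mulgVK.
rewrite defx in neq; have [g [u [gB uU E]]] := word_exit Ssym wS neq.
rewrite /= defx E; apply/imfset2P; exists g.
  by apply: (fsubsetP (sub_word_ball le_r)); rewrite -szw.
by exists u.
Qed.

Lemma finite_boundary (R : realType) (r : nat) (U : {fset G}) :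
  symmetric_gens S -> generates S -> finite_set (boundary S (r%:R : R) U).
Proof.
move=> Ssym gen; apply: (sub_finite_set (boundary_sub (U := U) Ssym gen)).
exact: finite_fset.
Qed.

(** The factor [#|word_ball r|] does not depend on [U], so along a Følner sequence the right-hand
    side is negligible against [|U|]. *)
Lemma card_boundary (R : realType) (r : nat) (U : {fset G}) :
  symmetric_gens S -> generates S ->
  (#|` fset_set (boundary S (r%:R : R) U)| <=
   #|` word_ball r| * #|` [fset (s * x)%g | s in S, x in U] `\` U|%fset)%N.
Proof.
move=> Ssym gen.
have := @boundary_sub R r U Ssym gen; rewrite fset_set_sub //; last first.
  exact: finite_boundary.
rewrite set_fsetK => /fsubset_leq_card/leq_trans; apply.
exact: leq_card_imfset2.
Qed.

Lemma boundary_folner (R : realType) (r : nat) (U : nat -> {fset G}) :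
  symmetric_gens S -> generates S -> folner R S U ->
  (fun j => #|` fset_set (boundary S (r%:R : R) (U j))|%:R / #|` U j|%:R : R)
    @ \oo --> (0 : R).
Proof.
move=> Ssym gen [_]; apply: (@cvg0_le_mul _ #|` word_ball r|%:R) => j.
rewrite divr_ge0 //= mulrA ler_wpM2r ?invr_ge0 //.
by rewrite -natrM ler_nat card_boundary.
Qed.

End Words.

(** * Finite disjoint families and almost additivity *)

Lemma sum_card_disjoint (T K : choiceType) (r : seq T) (f : T -> {fset K})
    (V : {fset K}) :
  uniq r -> {in r &, forall i j, i != j -> [disjoint f i & f j]%fset} ->
  {in r, forall i, (f i `<=` V)%fset} -> (\sum_(i <- r) #|` f i| <= #|` V|)%N.
Proof.
elim: r V => [|a r IH] V /=; first by rewrite big_nil.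
move=> /andP[ar ur] disj sub; rewrite big_cons.
have faV : (f a `<=` V)%fset by apply: sub; rewrite inE eqxx.
rewrite -(cardfsID (f a) V) (fsetIidPr faV) leq_add2l; apply: IH => //.
  by move=> i j ir jr; apply: disj; rewrite inE ?ir ?jr orbT.
move=> i ir; rewrite fsubsetD sub ?inE ?ir ?orbT //=.
by apply: disj; rewrite ?inE ?ir ?eqxx ?orbT //; apply: contraNneq ar => <-.
Qed.

Section AlmostAdditive.
Variables (G : groupType) (R : realType) (X : completeNormedModType R).
Variables (b : {fset G} -> R) (F : {fset G} -> X) (D : R).
Hypotheses (Fadd : almost_additive b F) (b_le : forall V, b V <= D * #|` V|%:R).

(** Two copies of the empty set are disjoint, so almost additivity bounds [|F fset0|] by
    [2 b(fset0)], which is at most 0 by the linear bound on [b]. It settles the empty list below, as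
    [almost_additive] speaks of nonempty families only. *)
Lemma almost_additive0 : F fset0 = 0.
Proof.
have b0 : b fset0 <= 0 by have := b_le fset0; rewrite cardfs0 mulr0.
have := Fadd (m := 1) (Q := fun=> fset0) (fun _ _ _ => fdisjoint0X _).
rewrite big1 // !big_ord_recl !big_ord0 !addr0 opprD addNKr normrN => le_b.
apply/eqP; rewrite -normr_le0; apply: le_trans le_b _.
by rewrite -[leRHS]addr0 lerD.
Qed.

Lemma almost_additive_seq (T : choiceType) (r : seq T) (f : T -> {fset G}) :
  uniq r -> {in r &, forall i j, i != j -> [disjoint f i & f j]%fset} ->
  `|F (\bigcup_(i <- r) f i)%fset - \sum_(i <- r) F (f i)|
    <= \sum_(i <- r) b (f i).
Proof.
case: r => [|a r] ur disj.
  by rewrite !big_nil almost_additive0 subr0 normr0.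
rewrite !(big_tnth _ _ (a :: r)); apply: Fadd => i j neq_ij.
apply: disj; rewrite ?mem_tnth //.
apply: contra_neq neq_ij; move: i j.
exact/(tuple_uniqP (in_tuple (a :: r))).
Qed.

End AlmostAdditive.

(** * Tilings and their right shifts *)

Section Tiling.
Variables (G : groupType) (Q : {fset G}).

Lemma mem_rtrans (x z : G) : (z \in rtrans Q x) = ((z * x^-1)%g \in Q).
Proof.
apply/imfsetP/idP => [[y yQ ->]|zQ]; first by rewrite mulgK.
by exists (z * x^-1)%g; rewrite ?mulgVK.
Qed.

Lemma card_rtrans (x : G) : #|` rtrans Q x| = #|` Q|.
Proof. by apply: card_imfset; apply: mulIg. Qed.

Variable K : set G.
Hypotheses (K_disj : forall g h, K g -> K h -> g <> h ->
              [disjoint rtrans Q g & rtrans Q h]%fset)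
  (K_cover : \bigcup_(g in K) [set` rtrans Q g] = [set: G]).

Lemma tile_inj (g h y : G) : K g -> K h ->
  y \in rtrans Q g -> y \in rtrans Q h -> g = h.
Proof.
move=> Kg Kh yg yh; apply: contrapT => /(K_disj Kg Kh)/fdisjointP/(_ _ yg).
by rewrite yh.
Qed.

Lemma tile_exists (y : G) : exists2 g, K g & y \in rtrans Q g.
Proof. by have : [set: G] y by []; rewrite -K_cover => -[g Kg yg]; exists g. Qed.

(* As [K = K^-1], the tiling [G = \bigcup_(g in K) Q g] inverts to
   [G = \bigcup_(x in Q) K x^-1], again a disjoint union. *)
Lemma tile_shift_unique (z : G) : K = [set (g^-1)%g | g in K] ->
  exists2 x, x \in Q & forall y, (y \in Q) && `[< K (z * y)%g >] = (y == x).
Proof.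
move=> Ksym; have KV g : K g -> K g^-1%g by rewrite {2}Ksym => Kg; exists g.
have [g Kg] := tile_exists z^-1%g; rewrite mem_rtrans -invgM => xQ.
exists (g * z)^-1%g => // y; apply/andP/eqP => [[yQ /asboolP Kzy]|->].
  have zg : z^-1%g \in rtrans Q g by rewrite mem_rtrans -invgM.
  have zzy : z^-1%g \in rtrans Q (z * y)^-1%g.
    by rewrite mem_rtrans invgK mulKg.
  have -> : g = (z * y)^-1%g by apply: tile_inj zg zzy; last exact: KV.
  by rewrite invgM invgK mulKg.
split => //; apply/asboolP; rewrite invgM mulgA mulgV mul1g; exact: KV.
Qed.

Variable U : {fset G}.

(* The only [z] for which [Q z] can meet [U]. *)
Definition meeting : {fset G} := [fset (q^-1 * u)%g | q in Q, u in U]%fset.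

Lemma rtrans_meeting (y z : G) : y \in rtrans Q z -> y \in U -> z \in meeting.
Proof.
rewrite mem_rtrans => yQ yU; apply/imfset2P; exists (y * z^-1)%g => //.
by exists y; rewrite // invgM invgK mulgVK.
Qed.

(** The index set [K x^-1] of the tiling shifted by [x^-1], cut down to [meeting] to make it a
    finite list. The omitted tiles do not meet [U]. *)
Definition shifted_tiles (x : G) : seq G :=
  [seq z <- meeting | `[< K (z * x)%g >]].

Lemma shifted_tiles_uniq x : uniq (shifted_tiles x).
Proof. exact/filter_uniq/fset_uniq. Qed.

(** Right multiplication by [x] carries these tiles to tiles of the original tiling; the same
    transport gives the covering of [U] below. *)
Lemma shifted_tiles_disjoint x : {in shifted_tiles x &, forall z z', z != z' ->
  [disjoint rtrans Q z `&` U & rtrans Q z' `&` U]%fset}.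
Proof.
move=> z z'; rewrite !mem_filter => /andP[/asboolP Kz _] /andP[/asboolP Kz' _].
apply: contra_neqT; rewrite -fsetI_eq0 => /fset0Pn[y].
rewrite !inE => /andP[/andP[yz _] /andP[yz' _]]; apply: (mulIg x).
apply: (tile_inj (y := (y * x)%g) Kz Kz'); rewrite mem_rtrans invgM mulgA mulgK.
  by rewrite -mem_rtrans.
by rewrite -mem_rtrans.
Qed.

Lemma shifted_tiles_cover x :
  U = (\bigcup_(z <- shifted_tiles x) (rtrans Q z `&` U))%fset.
Proof.
apply/fsetP => u; apply/idP/bigfcupP => [uU|[z _ /fsetIP[]]//].
have [g Kg ug] := tile_exists (u * x)%g.
have uz : u \in rtrans Q (g * x^-1)%g.
  by move: ug; rewrite !mem_rtrans invgM invgK mulgA.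
exists (g * x^-1)%g; last by rewrite inE uz.
rewrite andbT mem_filter mulgVK (rtrans_meeting uz uU) andbT; exact/asboolP.
Qed.

(** A tile that sticks out of [U] has a point outside [U], and by right invariance of the metric any
    two points of a tile are within [diam S Q] of each other. *)
Lemma not_sub_int_boundary (R : realType) (S : {fset G}) (y z : G) :
  y \in rtrans Q z -> y \in U -> ~~ (rtrans Q z `<=` U)%fset ->
  int_boundary S ((diam S Q)%:R : R) U y.
Proof.
move=> yz yU /fsubsetPn[y' y'z y'U]; split => //; apply/set_dist_le.
exists y'; first exact/negP.
rewrite -(word_distMr S y y' z^-1%g).
by apply: word_dist_diam; rewrite -mem_rtrans.
Qed.

End Tiling.

(** * Counting occurrences of patterns *)

Section PatternCount.
Variables (G : groupType) (A : finType) (C : G -> A) (Q : {fset G}).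

(** The colouring on [Q z] pulled back to [Q]: patterns at different places become elements of one
    finite type, over which sums can be partitioned. *)
Definition pattern_at (z : G) : {ffun Q -> A} :=
  [ffun y : Q => C (val y * z)%g].

Lemma fnd_restriction (U : {fset G}) (y : G) :
  (restriction C U).[? y]%fmap = if y \in U then Some (C y) else None.
Proof.
have [yU|yU] := boolP (y \in U); last by rewrite not_fnd.
by rewrite (in_fnd (yU : y \in domf (restriction C U))) ffunE.
Qed.

Lemma restriction_rtrans (z : G) :
  restriction C (rtrans Q z) = translate (FinMap (pattern_at z)) z.
Proof.
apply/fmapP => y; rewrite fnd_translate fnd_restriction mem_rtrans.
have [yQ|yQ] := boolP (y * z^-1 \in Q)%g; last by rewrite not_fnd.
rewrite (in_fnd (yQ : _ \in domf (FinMap (pattern_at z)))).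
by rewrite ffunE /= mulgVK.
Qed.

Lemma translate_inj (P P' : {fmap G -> A}) (z : G) :
  translate P z = translate P' z -> P = P'.
Proof.
move=> /fmapP eqPP'; apply/fmapP => y.
by have := eqPP' (y * z)%g; rewrite !fnd_translate mulgK.
Qed.

Lemma occurrences_pattern (U : {fset G}) (P : {ffun Q -> A}) (z : G) :
  occurrences (FinMap P) (restriction C U) z <->
  (rtrans Q z `<=` U)%fset && (pattern_at z == P).
Proof.
have restr : (rtrans Q z `<=` U)%fset ->
    (restriction C U).[& rtrans Q z]%fmap = translate (FinMap (pattern_at z)) z.
  move=> /fsubsetP sub; rewrite -restriction_rtrans; apply/fmapP => y.
  rewrite fnd_restrict !fnd_restriction.
  by have [/sub->|//] := boolP (y \in rtrans Q z).
rewrite /occurrences /=; split=> [[sub]|/andP[sub /eqP <-]].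
  rewrite sub restr // => /translate_inj/fmapP E; apply/eqP/ffunP => -[y yQ].
  have := E y; rewrite (in_fnd (yQ : y \in domf (FinMap (pattern_at z)))).
  by rewrite (in_fnd (yQ : y \in domf (FinMap P))) => -[].
by split=> //; exact: restr.
Qed.

Variables (R : realType) (X : completeNormedModType R) (F : {fset G} -> X).

Lemma Ftilde_pattern (z : G) : pattern_invariant C F ->
  Ftilde C F (FinMap (pattern_at z)) = F (rtrans Q z).
Proof.
move=> Finv; apply: FtildeE => //; right; exists z; exact: restriction_rtrans.
Qed.

Lemma norm_Ftilde_le (c : R) (P : {ffun Q -> A}) : 0 <= c ->
  (forall V, `|F V| <= c * #|` V|%:R) ->
  `|Ftilde C F (FinMap P)| <= c * #|` Q|%:R.
Proof.
(* The default value 0 satisfies the bound trivially. Otherwise the value is some [F V] with [Q] a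
   translate of [V], hence of the same size. *)
move=> c0 F_le; rewrite /Ftilde; case: pselect => [e|_]; last first.
  by rewrite normr0 mulr_ge0.
case: cid => V /= /equivalentP[x defP].
have -> : Q = rtrans V x by have := congr1 (@domf _ _) defP.
by rewrite card_rtrans.
Qed.

(** Group the translates inside [U] by the pattern they carry: [F] is constant on each group, and
    the size of the group is the number of occurrences. A point of [Q] shows that occurrences are
    finite in number and lie in [meeting]. *)
Lemma sum_occ_count (U : {fset G}) : pattern_invariant C F -> Q != fset0 ->
  \sum_(P : {ffun Q -> A})
    (occ_count (FinMap P) (restriction C U))%:R *: Ftilde C F (FinMap P) =
  \sum_(z <- meeting Q U | (rtrans Q z `<=` U)%fset) F (rtrans Q z).
Proof.
move=> Finv Q0; rewrite [RHS](partition_big pattern_at xpredT) //=.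
apply: eq_bigr => P _.
pose at_P z := (rtrans Q z `<=` U)%fset && (pattern_at z == P).
have -> : \sum_(z <- meeting Q U | at_P z) F (rtrans Q z) =
    \sum_(z <- meeting Q U | at_P z) Ftilde C F (FinMap P).
  by apply: eq_bigr => z /andP[_ /eqP <-]; rewrite Ftilde_pattern.
rewrite -[RHS]big_filter scaler_nat.
have fin : finite_set (occurrences (FinMap P) (restriction C U)).
  exact: finite_occurrences.
rewrite (perm_big (fset_set (occurrences (FinMap P) (restriction C U)))) /=.
  by rewrite big_const_seq count_predT iter_addr_0.
rewrite perm_sym; apply: uniq_perm => [||z].
- exact: fset_uniq.
- exact/filter_uniq/fset_uniq.
rewrite in_fset_set // mem_filter; apply/idP/andP.
  rewrite inE => /occurrences_pattern occ; split=> //.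
  have /fset0Pn[y yQ] := Q0; have /andP[/fsubsetP sub _] := occ.
  have yz : (y * z)%g \in rtrans Q z by rewrite mem_rtrans mulgK.
  exact: rtrans_meeting yz (sub _ yz).
by move=> [occ _]; rewrite inE; apply/occurrences_pattern.
Qed.

End PatternCount.

(** * Averaging over the shifted tilings *)

Section Averaging.
Variables (G : groupType) (S : {fset G}).
Hypotheses (Ssym : symmetric_gens S) (Sgen : generates S).
Variables (R : realType) (X : completeNormedModType R).
Variables (b : {fset G} -> R) (F : {fset G} -> X) (c D : R).
Hypotheses (Fadd : almost_additive b F) (c_ge0 : 0 <= c) (D_ge0 : 0 <= D).
Hypotheses (F_le : forall V, `|F V| <= c * #|` V|%:R)
  (b_le : forall V, b V <= D * #|` V|%:R)
  (b_ge0 : forall V, 0 <= b V) (b_inv : forall V x, b (rtrans V x) = b V).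
Variables (Q : {fset G}) (K : set G) (U : {fset G}).
Hypotheses (Q_neq0 : Q != fset0) (K_sym : K = [set (g^-1)%g | g in K])
  (K_disj : forall g h, K g -> K h -> g <> h ->
     [disjoint rtrans Q g & rtrans Q h]%fset)
  (K_cover : \bigcup_(g in K) [set` rtrans Q g] = [set: G]).

Let bd : R := #|` fset_set (boundary S ((diam S Q)%:R : R) U)|%:R.

Lemma card_tile_gt0 : 0 < #|` Q|%:R :> R.
Proof. by rewrite ltr0n cardfs_gt0. Qed.

(** The inner tiles are disjoint in [U], so there are at most [|U| / |Q|] of them, each with error
    [b Q]. The other pieces fill at most the boundary; they cost [D] per point for the additivity
    error and [c] per point for being dropped from the sum. *)
Lemma tiling_estimate (x : G) :
  `|F U - \sum_(z <- shifted_tiles Q K U x | (rtrans Q z `<=` U)%fset)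
            F (rtrans Q z)|
    <= #|` U|%:R / #|` Q|%:R * b Q + (c + D) * bd.
Proof.
set r := shifted_tiles Q K U x.
pose inn z := (rtrans Q z `<=` U)%fset; pose f z := (rtrans Q z `&` U)%fset.
have ur : uniq r by exact: shifted_tiles_uniq.
have disj : {in r &, forall z z', z != z' -> [disjoint f z & f z']%fset}.
  exact: shifted_tiles_disjoint.
have fE z : inn z -> f z = rtrans Q z by move=> /fsetIidPl.
have filtered_disj p : {in [seq z <- r | p z] &, forall z z', z != z' ->
    [disjoint f z & f z']%fset}.
  move=> z z'; rewrite [z \in _]mem_filter [z' \in _]mem_filter.
  by move=> /andP[_ zr] /andP[_ z'r]; apply: disj.
have out_le : (\sum_(z <- r | ~~ inn z) #|` f z|)%:R <= bd.
  rewrite ler_nat -big_filter; apply: sum_card_disjoint => //.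
    exact: filter_uniq.
  move=> z; rewrite mem_filter => /andP[out _]; apply/fsubsetP => y.
  move=> /fsetIP[yz yU]; rewrite in_fset_set; last exact: finite_boundary.
  by rewrite inE; left; apply: not_sub_int_boundary yz yU out.
have in_le : (\sum_(z <- r | inn z) #|` f z|)%:R <= #|` U|%:R :> R.
  rewrite ler_nat -big_filter; apply: sum_card_disjoint => //.
    exact: filter_uniq.
  by move=> z _; apply: fsubsetIr.
have := almost_additive_seq Fadd b_le ur disj.
rewrite -(shifted_tiles_cover K_cover) => approx.
have -> : F U - \sum_(z <- r | inn z) F (rtrans Q z) =
    (F U - \sum_(z <- r) F (f z)) + \sum_(z <- r | ~~ inn z) F (f z).
  rewrite [\sum_(z <- r) _](bigID inn) /= opprD addrA subrK; congr (_ - _).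
  by apply: eq_bigr => z /fE ->.
apply: le_trans (ler_normD _ _) _; rewrite mulrDl addrCA [leRHS]addrC.
apply: lerD; last first.
  apply: le_trans (ler_norm_sum _ _ _) _.
  apply: (@le_trans _ _ (\sum_(z <- r | ~~ inn z) c * #|` f z|%:R)).
    by apply: ler_sum => z _; apply: F_le.
  by rewrite -mulr_sumr -natr_sum ler_wpM2l.
apply: le_trans approx _; rewrite (bigID inn) /= ; apply: lerD.
  (* Every inner tile has [|Q|] points, so their number is their total size over [|Q|]. *)
  have -> : \sum_(z <- r | inn z) b (f z) =
      (\sum_(z <- r | inn z) #|` f z|)%:R / #|` Q|%:R * b Q.
    rewrite natr_sum !mulr_suml; apply: eq_bigr => z /fE ->.
    by rewrite card_rtrans b_inv mulfV ?mul1r // gt_eqF // card_tile_gt0.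
  by rewrite ler_wpM2r // ler_wpM2r // invr_ge0.
apply: (@le_trans _ _ (\sum_(z <- r | ~~ inn z) D * #|` f z|%:R)).
  by apply: ler_sum => z _; apply: b_le.
by rewrite -mulr_sumr -natr_sum ler_wpM2l.
Qed.

Lemma sum_shifted_tiles :
  \sum_(x <- Q) \sum_(z <- shifted_tiles Q K U x | (rtrans Q z `<=` U)%fset)
    F (rtrans Q z) =
  \sum_(z <- meeting Q U | (rtrans Q z `<=` U)%fset) F (rtrans Q z).
Proof.
under eq_bigr => x _ do rewrite big_filter_cond big_mkcondl.
rewrite exchange_big /=; apply: eq_bigr => z _; rewrite -big_mkcond.
(* After exchanging the sums, each [z] survives for exactly one shift [x] in [Q]; this is where the
   symmetry of [K] enters. *)
have [x xQ uniq_x] := tile_shift_unique K_disj K_cover z K_sym.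
rewrite big_seq_cond (eq_bigl (pred1 x)) => [|y]; last exact: uniq_x.
by rewrite -big_filter filter_pred1_uniq ?big_seq1 // fset_uniq.
Qed.

Lemma averaged_estimate :
  `|#|` Q|%:R *: F U -
     \sum_(z <- meeting Q U | (rtrans Q z `<=` U)%fset) F (rtrans Q z)|
    <= #|` Q|%:R * (#|` U|%:R / #|` Q|%:R * b Q + (c + D) * bd).
Proof.
have sumQ (V : lmodType R) (v : V) : #|` Q|%:R *: v = \sum_(x <- Q) v.
  by rewrite big_const_seq count_predT iter_addr_0 scaler_nat.
rewrite -sum_shifted_tiles sumQ -sumrB.
apply: le_trans (ler_norm_sum _ _ _) _.
rewrite [leRHS](sumQ R^o); apply: ler_sum => x _; exact: tiling_estimate.
Qed.

End Averaging.

(** * Limits from an estimate in two indices *)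

Lemma cvg_double_estimate (R : realType) (X : completeNormedModType R)
    (u v : nat -> X) (e : nat -> R) (g : nat -> nat -> R) :
  (forall j n, `|u j - v n| <= e n + g n j) ->
  e @ \oo --> (0 : R) -> (forall n, g n @ \oo --> (0 : R)) ->
  exists L : X, u @ \oo --> L /\ v @ \oo --> L.
Proof.
move=> uv_le e0 g0.
have e_lt eps : 0 < eps -> \forall n \near \oo, e n < eps.
  exact: cvgr_lt e0 eps.
have g_lt n eps : 0 < eps -> \forall j \near \oo, g n j < eps.
  exact: cvgr_lt (g0 n) eps.
(* Fix one [n] with [e n] small: all late [u j] lie in one small ball around [v n], and [X] is
   complete. *)
have u_cvg : cvg (u @ \oo).
  apply: cauchy_cvg; apply: cauchy_exP => eps eps0.
  have eps2 : 0 < eps / 2 by rewrite divr_gt0.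
  have [n en] := filter_ex (e_lt _ eps2).
  exists (v n); apply: filterS (g_lt n _ eps2) => j gnj.
  rewrite -ball_normE /= distrC; apply: le_lt_trans (uv_le j n) _.
  by rewrite [eps]splitr ltrD.
exists (lim (u @ \oo)); split=> //; apply/cvgrPdist_lt => eps eps0.
have eps3 : 0 < eps / 3 by rewrite divr_gt0.
apply: filterS (e_lt _ eps3) => n en.
(* The index [j] may depend on [n], since it only serves as an intermediate point between [v n] and
   the limit. *)
have [j [gnj uj]] := filter_ex (filterI (g_lt n _ eps3)
  (cvgr_dist_lt _ _ u_cvg _ eps3)).
rewrite -(subrKA (u j)); apply: le_lt_trans (ler_normD _ _) _.
have -> : eps = eps / 3 + (eps / 3 + eps / 3) by field.
by rewrite ltrD //; apply: le_lt_trans (uv_le j n) _; rewrite ltrD.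
Qed.

(** * The linear bound on [F] and the error estimate *)

Section MainEstimate.
Variables (G : groupType) (A : finType) (C : G -> A).
Variables (R : realType) (X : completeNormedModType R).
Variables (b : {fset G} -> R) (F : {fset G} -> X) (D : R).
Hypotheses (Fadd : almost_additive b F) (Finv : pattern_invariant C F).
Hypotheses (D_gt0 : 0 < D) (b_le : forall V, b V <= D * #|` V|%:R).

(** Cut [V] into points. By invariance [F] takes only finitely many values on points, one per
    colour, so [M] bounds them all; the additivity error is at most [D] per point. Adding [D] also
    makes the constant positive when [M = 0]. *)
Lemma norm_linear_bound :
  exists2 c : R, 0 < c & forall V, `|F V| <= c * #|` V|%:R.
Proof.
pose one : {fset G} := [fset 1%g]%fset.
pose M := \sum_(P : {ffun one -> A}) `|Ftilde C F (FinMap P)|.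
have M0 : 0 <= M by apply: sumr_ge0.
have F_point g : `|F (rtrans one g)| <= M.
  rewrite -(Ftilde_pattern _ _ Finv) /M (bigD1 (pattern_at C one g)) //=.
  by rewrite lerDl sumr_ge0.
have in_point y g : (y \in rtrans one g) = (y == g).
  by rewrite mem_rtrans inE mulg_eq1 invgK.
exists (M + D) => [|V]; first by rewrite ltr_wpDl.
have points_disj : {in V &, forall g h, g != h ->
    [disjoint rtrans one g & rtrans one h]%fset}.
  move=> g h _ _; apply: contra_neqT; rewrite -fsetI_eq0 => /fset0Pn[y].
  by rewrite !inE !in_point => /andP[/eqP <- /eqP].
have := almost_additive_seq Fadd b_le (fset_uniq V) points_disj.
have -> : (\bigcup_(g <- V) rtrans one g)%fset = V.
  apply/fsetP => y; apply/bigfcupP/idP => [[g]|yV].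
    by rewrite andbT in_point => gV /eqP ->.
  by exists y; rewrite ?in_point ?yV.
move=> approx; rewrite -(subrK (\sum_(g <- V) F (rtrans one g)) (F V)).
apply: le_trans (ler_normD _ _) _; rewrite mulrDl addrC.
have sumV (a : R) : a * #|` V|%:R = \sum_(g <- V) a.
  by rewrite big_const_seq count_predT iter_addr_0 mulr_natr.
apply: lerD.
  by rewrite sumV; apply: le_trans (ler_norm_sum _ _ _) _; apply: ler_sum.
apply: le_trans approx _; rewrite sumV; apply: ler_sum => g _.
by apply: le_trans (b_le _) _; rewrite card_rtrans cardfs1 mulr1.
Qed.

Variables (S : {fset G}) (c : R).
Hypotheses (Ssym : symmetric_gens S) (Sgen : generates S) (c_gt0 : 0 < c).
Hypotheses (F_le : forall V, `|F V| <= c * #|` V|%:R)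
  (b_ge0 : forall V, 0 <= b V) (b_inv : forall V x, b (rtrans V x) = b V).

(** Dividing the averaged estimate by [|U| |Q|] yields the first two terms. Replacing the empirical
    frequencies by [nu] yields the third, the factor [|Q|] in the bound on [Ftilde] cancelling the
    normalisation. *)
Lemma pattern_sum_estimate (Q U : {fset G}) (nu : {ffun Q -> A} -> R) :
  symmetrically_tiles Q -> Q != fset0 -> U != fset0 ->
  `|(#|` U|%:R)^-1 *: F U -
      \sum_(P : {ffun Q -> A}) (nu P / #|` Q|%:R) *: Ftilde C F (FinMap P)|
  <= b Q / #|` Q|%:R
     + (c + D) * (#|` fset_set (boundary S ((diam S Q)%:R : R) U)|%:R
                    / #|` U|%:R)
     + c * \sum_(P : {ffun Q -> A})
             `|(occ_count (FinMap P) (restriction C U))%:R / #|` U|%:R - nu P|.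
Proof.
move=> [K [Ksym Kdisj Kcover]] Q0 U0.
have := averaged_estimate Ssym Sgen Fadd (ltW c_gt0) (ltW D_gt0) F_le b_le b_ge0
  b_inv U Q0 Ksym Kdisj Kcover.
rewrite -(sum_occ_count U Finv Q0).
pose occ (P : {ffun Q -> A}) : R := (occ_count (FinMap P) (restriction C U))%:R.
set u := #|` U|%:R; set q := #|` Q|%:R; set bd : R := #|` _|%:R.
have u0 : 0 < u :> R by rewrite ltr0n cardfs_gt0.
have q0 : 0 < q :> R by rewrite ltr0n cardfs_gt0.
have [un0 qn0] : u != 0 /\ q != 0 by rewrite !gt_eqF.
pose FP (P : {ffun Q -> A}) := Ftilde C F (FinMap P).
have uq0 : 0 <= (u * q)^-1 by rewrite invr_ge0 mulr_ge0 // ltW.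
set s := _ - _ => s_le.
have -> : u^-1 *: F U - \sum_P (nu P / q) *: FP P =
    (u * q)^-1 *: s + \sum_P ((occ P / u - nu P) / q) *: FP P.
  rewrite /s scalerBr scalerA.
  have -> : (u * q)^-1 * q = u^-1 by field; rewrite un0 qn0.
  rewrite -addrA scaler_sumr; congr (_ + _).
  rewrite -!sumrN -big_split /=; apply: eq_bigr => P _.
  rewrite scalerA -[LHS]scaleNr -[X in _ = X + _]scaleNr -scalerDl.
  rewrite -/(occ P); congr (_ *: _).
  by field; rewrite un0 qn0.
apply: le_trans (ler_normD _ _) _; apply: lerD.
  rewrite normrZ (ger0_norm uq0).
  have -> : b Q / q + (c + D) * (bd / u) =
      (u * q)^-1 * (q * (u / q * b Q + (c + D) * bd)).
    by field; rewrite un0 qn0.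
  by rewrite ler_wpM2l.
apply: le_trans (ler_norm_sum _ _ _) _; rewrite mulr_sumr.
apply: ler_sum => P _; rewrite normrZ normrM normfV (gtr0_norm q0).
rewrite -/(occ P); set a := `|occ P / u - nu P|.
apply: (@le_trans _ _ (a / q * (c * q))).
  rewrite ler_wpM2l ?divr_ge0 ?normr_ge0 //.
  exact: norm_Ftilde_le (ltW c_gt0) F_le.
by rewrite mulrCA divfK.
Qed.

End MainEstimate.

Theorem theorem3p1 (R : realType) (G : groupType) (S : {fset G})
    (Ssym : symmetric_gens S) (Sgen : generates S) (Gam : amenable R S)
    (A : finType) (C : G -> A)
    (Q : nat -> {fset G}) (Qfolner : folner R S Q)
    (Qtiles : forall n, symmetrically_tiles (Q n))
    (U : nat -> {fset G}) (Ufolner : folner R S U)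
    (Ufreq : forall n (P : {ffun Q n -> A}),
       cvg ((fun j => (occ_count (FinMap P) (restriction C (U j)))%:R
                        / #|` U j|%:R : R) @ \oo))
    (X : completeNormedModType R) (F : {fset G} -> X) (b : {fset G} -> R)
    (Finv : pattern_invariant C F) (bterm : boundary_term S b)
    (Fadd : almost_additive b F) :
  let avg (j : nat) : X := (#|` U j|%:R)^-1 *: F (U j) in
  let freq_sum (n : nat) : X :=
    \sum_(P : {ffun Q n -> A})
      (frequency R C U (FinMap P) / #|` Q n|%:R) *: Ftilde C F (FinMap P) in
  [/\ exists2 c : R, 0 < c & forall V, `|F V| <= c * #|` V|%:R,
      exists Fbar : X, avg @ \oo --> Fbar /\ freq_sum @ \oo --> Fbar
    & forall c D : R, 0 < c -> 0 < D ->
        (forall V, `|F V| <= c * #|` V|%:R) ->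
        (forall V, b V <= D * #|` V|%:R) ->
      forall j n,
        `|avg j - freq_sum n| <=
          b (Q n) / #|` Q n|%:R
          + (c + D) * (#|` fset_set (boundary S ((diam S (Q n))%:R : R) (U j))|%:R
                        / #|` U j|%:R)
          + c * \sum_(P : {ffun Q n -> A})
                  `|(occ_count (FinMap P) (restriction C (U j)))%:R
                      / #|` U j|%:R - frequency R C U (FinMap P)| ].
Proof.
move=> avg freq_sum; have [b_ge0 b_inv b_folner [D0 D0_gt0 b_le0]] := bterm.
have [Q_neq0 _] := Qfolner; have [U_neq0 _] := Ufolner.
have [c0 c0_gt0 F_le0] := norm_linear_bound Fadd Finv D0_gt0 b_le0.
have main (c D : R) : 0 < c -> 0 < D -> (forall V, `|F V| <= c * #|` V|%:R) ->
    (forall V, b V <= D * #|` V|%:R) ->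
    forall j n, `|avg j - freq_sum n| <= _ :=
  fun c_gt0 D_gt0 F_le b_le j n =>
    pattern_sum_estimate Fadd Finv D_gt0 b_le Ssym Sgen c_gt0 F_le b_ge0 b_inv
      (fun P => frequency R C U (FinMap P)) (Qtiles n) (Q_neq0 n) (U_neq0 j).
split; [by exists c0| |exact: main].
(* [g n j] collects the errors that vanish as [j] grows with [n] fixed; the remaining
   [b (Q n) / |Q n|] vanishes as [n] grows, by the boundary term property along [Q]. *)
pose g n j : R :=
  (c0 + D0) * (#|` fset_set (boundary S ((diam S (Q n))%:R : R) (U j))|%:R
                 / #|` U j|%:R)
  + c0 * \sum_(P : {ffun Q n -> A})
           `|(occ_count (FinMap P) (restriction C (U j)))%:R / #|` U j|%:R
             - frequency R C U (FinMap P)|.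
apply: (cvg_double_estimate (g := g) _ (b_folner _ Qfolner)).
  by move=> j n; rewrite /g addrA; exact: main.
have boundary0 n := @boundary_folner _ _ R (diam S (Q n)) U Ssym Sgen Ufolner.
(* For fixed [n] there are finitely many patterns on [Q n], so convergence of each frequency
   suffices. *)
have freq0 n : (fun j => \sum_(P : {ffun Q n -> A})
    `|(occ_count (FinMap P) (restriction C (U j)))%:R / #|` U j|%:R
      - frequency R C U (FinMap P)|) @ \oo --> (0 : R).
  apply: cvg0_sum => P; rewrite -(@normr0 R R); apply: cvg_norm.
  rewrite -(subrr (frequency R C U (FinMap P))).
  by apply: cvgB; [exact: Ufreq|exact: cvg_cst].
move=> n; have := cvgD (cvgM (cvg_cst (c0 + D0)) (boundary0 n))
  (cvgM (cvg_cst c0) (freq0 n)).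
by rewrite !mulr0 addr0; apply.
Qed.
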